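(* For every $\rho\neq 0$, the following identity of operators on $\mathbb{K}$ holds: $$(2\,\mathrm{Prox}_{\bar f}-\mathcal{I})\circ(2\,\mathrm{Prox}_{\widehat g}-\mathcal{I})=(2\,\mathrm{Prox}_{\bar f^*\circ(-\mathcal{I})}-\mathcal{I})\circ(2\,\mathrm{Prox}_{\widehat g^*}-\mathcal{I}).$$
   Context: $\mathbb{H},\mathbb{P},\mathbb{K}$ are real Hilbert spaces; $\Gamma_0(\cdot)$ denotes convex, closed, proper functions with values in $(-\infty,+\infty]$. Let $f\in\Gamma_0(\mathbb{H})$, $g\in\Gamma_0(\mathbb{P})$, $\bm{c}\in\mathbb{K}$, and let $\mathcal{A}:\mathbb{H}\to\mathbb{K}$, $\mathcal{B}:\mathbb{P}\to\mathbb{K}$ be injective bounded linear operators whose inverses $\mathcal{A}^{-1}:\mathbb{K}\to\mathbb{H}$, $\mathcal{B}^{-1}:\mathbb{K}\to\mathbb{P}$ are bounded linear operators. For $\rho\neq0$ define, for $\bm{y}\in\mathbb{K}$, $$\bar f(\bm{y})=f\big((\rho\mathcal{A})^{-1}\bm{y}\big)-\langle\rho\bm{c},\bm{y}\rangle,\qquad \widehat g(\bm{y})=g\big((\rho\mathcal{B})^{-1}\bm{y}\big)+\langle\rho\bm{c},\bm{y}\rangle .$$ For a function $h$, $\mathrm{Prox}_h(\bm{v})=\mathrm{argmin}_{\bm{z}}\,h(\bm{z})+\frac12\Vert\bm{z}-\bm{v}\Vert^2$; $h^*(\cdot)=\sup_{\bm{z}}\langle\bm{z},\cdot\rangle-h(\bm{z})$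 is the Fenchel conjugate; $\mathcal{I}$ is the identity; $\bar f^*\circ(-\mathcal{I})$ is the function $\bm{y}\mapsto\bar f^*(-\bm{y})$. *)

(* Defs.v *)
From HB Require Import structures.
From mathcomp Require Import all_boot all_order all_algebra.
From mathcomp Require Import all_classical all_reals all_analysis.
Set Implicit Arguments.
Unset Strict Implicit.
Unset Printing Implicit Defensive.
Import Order.TTheory GRing.Theory Num.Theory.
Import numFieldNormedType.Exports.

Local Open Scope classical_set_scope.
Local Open Scope ring_scope.

HB.mixin Record CompleteNormedModule_isHilbert (R : realType) V
    of CompleteNormedModule R V := {
  inner : {dot V for idfun} ;
  inner_norm : forall x : V, inner x x = `|x| ^+ 2
}.

#[short(type="hilbertType")]
HB.structure Definition Hilbert (R : realType) :=
  { V of CompleteNormedModule_isHilbert R V & CompleteNormedModule R V }.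

Notation "''<[' x , y ]>" := (inner x y)
  (at level 8, format "''<[' x ,  y ]>") : ring_scope.

Section Gamma0.
Context {R : realType} {V : normedModType R}.
Implicit Type f : V -> \bar R.

Definition proper_fun f := (forall x, f x != -oo%E) /\ (exists x, f x != +oo%E).

(* The convention 0 * +oo = 0 makes the cases t = 0 and t = 1 trivial. *)
Definition convex_fun f := forall (x y : V) (t : R), 0 <= t -> t <= 1 ->
  (f (t *: x + (1 - t) *: y)%R <= t%:E * f x + (1 - t)%:E * f y)%E.

Definition epigraph f : set (V * R) := [set p | (f p.1 <= p.2%:E)%E].

Definition Gamma0 f := [/\ proper_fun f, convex_fun f & closed (epigraph f)].

End Gamma0.

Definition bounded_linear {R : realType} {U V : normedModType R} (T : U -> V) :=
  linear T /\ exists M : R, forall x, `|T x| <= M * `|x|.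

(* [pinv setT T] is the two-sided inverse of T when T is bijective. *)
Definition inv_op {R : realType} {U V : normedModType R} (T : U -> V) :
  V -> U := pinv setT T.

(* Surjectivity expresses that the inverse is defined on the whole of V. *)
Definition bounded_linear_iso {R : realType} {U V : normedModType R}
    (T : U -> V) :=
  [/\ bounded_linear T, injective T, range T = setT &
      bounded_linear (inv_op T)].

Section prox.
Context {R : realType} {V : hilbertType R}.
Implicit Type h : V -> \bar R.

Definition argmin h : set V := [set p | forall z, (h p <= h z)%E].

(* [get] selects an element of the argmin, which is a singleton when
   [Gamma0 h]; its value is unspecified if the argmin is empty. *)
Definition prox h (v : V) : V :=
  get (argmin (fun z => (h z + (2^-1 * `|z - v| ^+ 2)%:E)%E)).

Definition rprox h (v : V) : V := 2 *: prox h v - v.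

Definition fenchel h (v : V) : \bar R :=
  ereal_sup (range (fun z => ('<[z, v]>%:E - h z)%E)).

End prox.

Definition fbar {R : realType} {H K : hilbertType R} (f : H -> \bar R)
    (A : H -> K) (c : K) (rho : R) (y : K) : \bar R :=
  (f (inv_op (fun x => rho *: A x) y) - '<[rho *: c, y]>%:E)%E.

Definition ghat {R : realType} {P K : hilbertType R} (g : P -> \bar R)
    (B : P -> K) (c : K) (rho : R) (y : K) : \bar R :=
  (g (inv_op (fun x => rho *: B x) y) + '<[rho *: c, y]>%:E)%E.

(* Main.v *)
From HB Require Import structures.
Require Import Defs.
From mathcomp Require Import all_boot all_order all_algebra.
From mathcomp Require Import all_classical all_reals all_analysis.
From mathcomp Require Import ring lra.
Set Implicit Arguments.
Unset Strict Implicit.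
Unset Printing Implicit Defensive.
Import Order.TTheory GRing.Theory Num.Theory.
Import numFieldNormedType.Exports.
Local Open Scope ring_scope.

(** Both [fbar f A c rho] and [ghat g B c rho] are again in Gamma0.  For [h] in
    Gamma0, Moreau's decomposition [prox h v + prox h^* v = v] turns [rprox h^*]
    into [- rprox h], and reflecting the argument gives
    [rprox (h^* \o -%R) v = rprox h (- v)]; the two signs cancel in the
    composition.  Moreau's decomposition needs that the minimum defining
    [prox h v] is attained: [h] has a minorant [b - k * `|z - x0|], so the
    objective is bounded below, and the parallelogram law makes minimizing
    sequences Cauchy. *)

(** * Inner product algebra and continuity *)

Section inner_product.
Context {R : realType} {V : hilbertType R}.
Implicit Types (x y z : V) (a : R).

Lemma innerC x y : '<[x, y]> = '<[y, x]>.
Proof. by rewrite hermC /= expr0 mul1r. Qed.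

Lemma innerDr x y z : '<[x, y + z]> = '<[x, y]> + '<[x, z]>.
Proof. exact: linearDr. Qed.

Lemma innerNr x y : '<[x, - y]> = - '<[x, y]>.
Proof. exact: linearNr. Qed.

Lemma innerZr x a y : '<[x, a *: y]> = a * '<[x, y]>.
Proof. exact: linearZr_LR. Qed.

Lemma innerBr x y z : '<[x, y - z]> = '<[x, y]> - '<[x, z]>.
Proof. by rewrite innerDr innerNr. Qed.

Lemma innerDl x y z : '<[x + y, z]> = '<[x, z]> + '<[y, z]>.
Proof. by rewrite innerC innerDr !(innerC z). Qed.

Lemma innerNl x y : '<[- x, y]> = - '<[x, y]>.
Proof. by rewrite innerC innerNr innerC. Qed.

Lemma innerZl x a y : '<[a *: x, y]> = a * '<[x, y]>.
Proof. by rewrite innerC innerZr innerC. Qed.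

Lemma innerBl x y z : '<[x - y, z]> = '<[x, z]> - '<[y, z]>.
Proof. by rewrite innerDl innerNl. Qed.

Lemma sqr_normD x y : `|x + y| ^+ 2 = `|x| ^+ 2 + 2 * '<[x, y]> + `|y| ^+ 2.
Proof.
by rewrite -!inner_norm innerDl !innerDr (innerC y x); ring.
Qed.

Lemma sqr_normB x y : `|x - y| ^+ 2 = `|x| ^+ 2 - 2 * '<[x, y]> + `|y| ^+ 2.
Proof. by rewrite sqr_normD innerNr normrN mulrN. Qed.

(** Polarization writes the inner product as a difference of squared norms, so continuity is
    inherited from the norm. *)
Lemma continuous_inner c : continuous (fun y : V => '<[c, y]>).
Proof.
have -> : (fun y : V => '<[c, y]>) =
    (fun y => 4^-1 * (`|c + y| ^+ 2 - `|c - y| ^+ 2)).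
  by apply/funext => y; rewrite sqr_normD sqr_normB; field.
move=> y; apply: cvgM; first exact: cvg_cst.
apply: cvgB.
  apply: (@continuous_comp _ _ _ (fun y => `|c + y|) (fun r : R => r ^+ 2)).
    by apply: cvg_norm; apply: cvgD; [exact: cvg_cst|exact: cvg_id].
  exact: exprn_continuous.
apply: (@continuous_comp _ _ _ (fun y => `|c - y|) (fun r : R => r ^+ 2)).
  by apply: cvg_norm; apply: cvgB; [exact: cvg_cst|exact: cvg_id].
exact: exprn_continuous.
Qed.

End inner_product.

(** * Bounded operators and inverses of scaled operators *)

Lemma bounded_linear_is_continuous {R : realType} {U W : normedModType R} (T : U -> W) :
  bounded_linear T -> continuous T.
Proof.
move=> [linT [M TM]].
pose L : {linear U -> W} := HB.pack T (GRing.isLinear.Build R U W *:%R T linT).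
apply: (@bounded_linear_continuous _ _ _ L); apply/linear_boundedP.
near=> r => x; apply: (le_trans (TM x)); apply: ler_wpM2r; first exact: normr_ge0.
by near: r; apply: nbhs_pinfty_ge; rewrite num_real.
Unshelve. all: by end_near. Qed.

(** The inverse of [a *: T] is [inv_op T] after scaling by [a^-1]. Its surjectivity later keeps
    compositions with it proper. *)
Lemma inv_op_scale_bounded_linear {R : realType} {U W : normedModType R}
    (T : U -> W) (a : R) : a != 0 -> bounded_linear_iso T ->
  bounded_linear (inv_op (fun x => a *: T x)) /\
  range (inv_op (fun x => a *: T x)) = setT.
Proof.
move=> a0 [_ injT surjT [linI [M IM]]].
have TK : cancel (inv_op T) T.
  by move=> y; apply: pinvK; rewrite surjT in_setT.
have invE y : inv_op (fun x => a *: T x) y = inv_op T (a^-1 *: y).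
  apply: injT; rewrite TK -[LHS]scale1r -(mulVf a0) -scalerA; congr (_ *: _).
  apply: (@pinvK _ _ _ setT (fun x => a *: T x)); apply/mem_set.
  exists (inv_op T (a^-1 *: y)) => //=.
  by rewrite TK scalerA divff// scale1r.
split; last first.
  apply/seteqP; split=> // x _; exists (a *: T x) => //.
  by rewrite invE scalerA mulVf// scale1r; apply: injT; rewrite TK.
split=> [b x y|].
  by rewrite !invE scalerDr scalerA mulrC -scalerA linI.
exists (M * `|a^-1|) => x.
by rewrite invE -mulrA -normrZ.
Qed.

(** * Stability of [Gamma0] *)

Section Gamma0_stability.
Context {R : realType}.

Lemma Gamma0_comp {U W : normedModType R} (h : U -> \bar R) (L : W -> U) :
  bounded_linear L -> range L = setT -> Gamma0 h -> Gamma0 (h \o L).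
Proof.
move=> bL surjL [[hNy [x0 hx0]] hconv hclosed]; split.
- split=> [x|]; first exact: hNy.
  have : range L x0 by rewrite surjL.
  by case=> w _ Lw; exists w; rewrite /= Lw.
- move=> x y t t0 t1 /=.
  have [linL _] := bL.
  have -> : L (t *: x + (1 - t) *: y) = t *: L x + (1 - t) *: L y.
    have L0 : L 0 = 0.
      by have := linL (-1) 0 0; rewrite scaler0 addr0 scaleN1r addNr.
    by rewrite linL -[(1 - t) *: y]addr0 linL L0 addr0.
  exact: hconv.
- pose F (p : W * R) := (L p.1, p.2).
  have -> : epigraph (h \o L) = (F @^-1` epigraph h)%classic by [].
  suff /continuous_closedP : continuous F by apply.
  move=> p; apply: (@cvg_pair _ _ _ (nbhs p) (nbhs (L p.1)) (nbhs p.2) _ _ _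
    (fun q => L q.1) snd); last exact: cvg_snd.
  apply: (@continuous_comp _ _ _ fst L); first exact: cvg_fst.
  exact: bounded_linear_is_continuous.
Qed.

Lemma Gamma0_add_inner {V : hilbertType R} (h : V -> \bar R) (c : V) :
  Gamma0 h -> Gamma0 (fun y => h y + '<[c, y]>%:E)%E.
Proof.
move=> [[hNy [x0 hx0]] hconv hclosed]; split.
- split=> [x|].
    by have := hNy x; case: (h x).
  by exists x0; move: hx0; case: (h x0).
- move=> x y t t0 t1.
  rewrite innerDr !innerZr.
  rewrite !muleDr ?fin_num_adde_defl// addeACA EFinD !EFinM.
  by apply: leeD => //; exact: hconv.
(* Adding a linear form shears the epigraph; [F] is the continuous shear that undoes this. *)
- pose F (p : V * R) := (p.1, p.2 - '<[c, p.1]>).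
  have -> : epigraph (fun y => h y + '<[c, y]>%:E)%E =
            (F @^-1` epigraph h)%classic.
    apply/funext => -[y a]; rewrite /epigraph /F /=.
    by rewrite EFinB leeBrDr.
  suff /continuous_closedP : continuous F by apply.
  move=> p; apply: (@cvg_pair _ _ _ (nbhs p) (nbhs p.1)
    (nbhs (p.2 - '<[c, p.1]>)) _ _ _ fst
    (fun q => q.2 - '<[c, q.1]>)); first exact: cvg_fst.
  apply: cvgB; first exact: cvg_snd.
  apply: (@continuous_comp _ _ _ fst (fun y => '<[c, y]>)); first exact: cvg_fst.
  exact: continuous_inner.
Qed.
End Gamma0_stability.

(** * Lower bounds and existence of proximal points *)

Lemma convex_fun_le {R : realType} {V : normedModType R} (h : V -> \bar R)
    (x y : V) (a b t : R) :
  convex_fun h -> 0 <= t -> t <= 1 -> (h x <= a%:E)%E -> (h y <= b%:E)%E ->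
  (h (t *: x + (1 - t) *: y)%R <= (t * a + (1 - t) * b)%:E)%E.
Proof.
move=> hconv t0 t1 ha hb; apply: (le_trans (hconv x y t t0 t1)).
rewrite [X in (_ <= X)%E]EFinD !EFinM; apply: leeD; apply: lee_wpmul2l; rewrite // -?EFinB.
by rewrite lee_fin subr_ge0.
Qed.

(** A point strictly below the graph at [x0] has a ball missing the closed epigraph, which bounds
    [h] below near [x0]. Convexity along segments from [x0] extends the bound, with linear loss. *)
Lemma Gamma0_minorant {R : realType} {V : normedModType R} (h : V -> \bar R) :
  Gamma0 h -> exists x0 b k, 0 < k /\
    forall z a, (h z <= a%:E)%E -> b - k * `|z - x0| <= a.
Proof.
move=> [[hNy [x0 hx0]] hconv hclosed].
have [b hb] : exists b, h x0 = b%:E.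
  by move: (hNy x0) hx0; case: (h x0) => // r _ _; exists r.
have nE : (~` epigraph h)%classic (x0, b - 1).
  by rewrite /epigraph /= hb lee_fin; apply/negP; rewrite -ltNge; lra.
have /nbhs_ballP[e /= e0 be] : nbhs (x0, b - 1) (~` epigraph h)%classic.
  by apply: open_nbhs_nbhs; split=> //; rewrite openC.
have lbE z a : `|z - x0| < e -> (h z <= a%:E)%E -> b - 1 <= a.
  move=> ze za; rewrite leNgt; apply/negP => ab.
  apply: (be (z, b - 1)).
    split=> /=; last exact: ballxx.
    by rewrite -ball_normE /= distrC.
  by rewrite /epigraph /=; apply: (le_trans za); rewrite lee_fin ltW.
exists x0, (b - 1), (2 / e); split; first by rewrite divr_gt0.
move=> z a za.
have N0 : 0 <= `|z - x0| by [].
have [ze|ze] := ltP `|z - x0| e.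
  apply: le_trans (lbE z a ze za).
  by rewrite gerBl mulr_ge0// divr_ge0// ltW.
have Npos : 0 < `|z - x0| by apply: lt_le_trans ze.
(* This [t] puts the point of the segment at distance [e / 2] from [x0], inside the ball. *)
pose t := e / (2 * `|z - x0|).
have t0 : 0 < t by rewrite divr_gt0// mulr_gt0.
have t1 : t <= 1 by rewrite ler_pdivrMr ?mulr_gt0// mul1r; lra.
have hb' : (h x0 <= b%:E)%E by rewrite hb.
have := convex_fun_le hconv (ltW t0) t1 za hb'.
have wE : t *: z + (1 - t) *: x0 = x0 + t *: (z - x0).
  by rewrite scalerBl scale1r scalerBr addrC -addrA [- _ + _]addrC.
move/lbE; rewrite wE addrAC subrr add0r normrZ gtr0_norm//.
have -> : t * `|z - x0| = e / 2 by rewrite /t; field; rewrite gt_eqF.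
move=> /(_ ltac:(lra)) H.
have -> : 2 / e * `|z - x0| = 1 / t.
  by rewrite /t; field; rewrite !gt_eqF.
have : -1 <= (a - b) * t by lra.
rewrite -ler_pdivrMr// mulNr => ?; lra.
Qed.
Lemma prox_exists {R : realType} {V : hilbertType R} (h : V -> \bar R) (v : V) :
  Gamma0 h -> exists p, argmin (fun z => h z + (2^-1 * `|z - v| ^+ 2)%:E)%E p.
Proof.
move=> hG; have [[hNy [y0 hy0]] hconv hclosed] := hG.
have [x0 [b [k [k0 hmin]]]] := Gamma0_minorant hG.
(* [S] collects the real upper bounds of values of the objective, so that its infimum is taken in
   [R]. *)
pose S : set R := [set r | exists z, (h z <= (r - 2^-1 * `|z - v| ^+ 2)%:E)%E]%classic.
have S0 : (S !=set0)%classic.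
  move: (hNy y0) hy0; case hE : (h y0) => [r| |]// _ _.
  exists (r + 2^-1 * `|y0 - v| ^+ 2), y0; rewrite hE lee_fin; lra.
have Slb : has_lbound S.
  (* The triangle inequality moves the minorant to [v]; then [k * n <= n ^+ 2 / 2 + k ^+ 2 / 2]
     absorbs the linear term. *)
  exists (b - k * `|v - x0| - 2^-1 * k ^+ 2) => r [z /hmin].
  have := ler_normD (z - v) (v - x0); rewrite addrA subrK.
  move: (`|z - x0|) (`|z - v|) (`|v - x0|) => n1 n2 n3 n13 H.
  have : k * n1 <= k * (n2 + n3) by rewrite ler_pM2l.
  have := sqr_ge0 (n2 - k); nra.
set m := inf S.
have mle z a : (h z <= a%:E)%E -> m <= a + 2^-1 * `|z - v| ^+ 2.
  by move=> za; apply: ge_inf => //; exists z; rewrite addrK.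
have /choice[u uP] : forall n : nat, exists z,
    (h z <= (m + n.+1%:R^-1 - 2^-1 * `|z - v| ^+ 2)%:E)%E.
  move=> n; have [||r [z zr] rm] := @inf_adherent _ S n.+1%:R^-1.
  - by rewrite invr_gt0.
  - by split.
  - exists z; apply: (le_trans zr); rewrite lee_fin lerD2r ltW//.
(* The objective at the midpoint of [u i] and [u j] is at least [m]; convexity and the parallelogram
   law turn this into a distance bound. *)
have udist i j : `|u i - u j| ^+ 2 <= 4 * (i.+1%:R^-1 + j.+1%:R^-1).
  have half0 : (0 : R) <= 2^-1 by lra.
  have half1 : (2^-1 : R) <= 1 by lra.
  have := mle _ _ (convex_fun_le hconv half0 half1 (uP i) (uP j)).
  have -> : 2^-1 *: u i + (1 - 2^-1) *: u j - v =
            2^-1 *: ((u i - v) + (u j - v)).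
    have -> : (1 - 2^-1 : R) = 2^-1 by lra.
    rewrite addrACA -opprD scalerBr scalerDr -[v + v]mulr2n -(scaler_nat 2 v).
    by rewrite scalerA mulVf// scale1r.
  have -> : u i - u j = (u i - v) - (u j - v) by rewrite opprB addrA subrK.
  move: (u i - v) (u j - v) => x y.
  rewrite normrZ ger0_norm// exprMn sqr_normB sqr_normD.
  move: (i.+1%:R^-1) (j.+1%:R^-1) (`|x| ^+ 2) (`|y| ^+ 2) '<[x, y]>.
  by move=> *; lra.
have [p ucvg] : exists p : V, (u @ \oo --> p)%classic.
  suff : cvg (u @ \oo)%classic by exists (lim (u @ \oo)%classic).
  apply/cauchy_cvgP/cauchy_exP => e e0.
  (* Two such terms multiplied by the 4 of [udist] stay below [e ^+ 2]. *)
  have [N _ HN] : \forall n \near \oo%classic, n.+1%:R^-1 < e ^+ 2 / 8.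
    have d0 : 0 < e ^+ 2 / 8 by rewrite divr_gt0// exprn_gt0.
    exact: (near_infty_natSinv_lt (PosNum d0)).
  exists (u N), N => // n /HN nN; rewrite -ball_normE /=.
  rewrite -(ltr_pXn2r (n := 2)) ?nnegrE ?normr_ge0 ?(ltW e0)//.
  have := HN N (leqnn N); have := udist N n; move: nN => /=.
  by move: (N.+1%:R^-1) (n.+1%:R^-1) => *; lra.
(* The points [w n] lie in the closed epigraph, hence so does their limit. *)
have hp : (h p <= (m - 2^-1 * `|p - v| ^+ 2)%:E)%E.
  pose w n := (u n, m + n.+1%:R^-1 - 2^-1 * `|u n - v| ^+ 2).
  apply: (@closed_cvg nat (V * R)%type \oo%classic _ w _ hclosed _
    (p, m - 2^-1 * `|p - v| ^+ 2)).
    by apply: nearW => n; exact: uP.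
  apply: (@cvg_pair _ _ _ \oo%classic (nbhs p)
    (nbhs (m - 2^-1 * `|p - v| ^+ 2)) _ _ _ u (snd \o w) ucvg).
  apply: cvgB.
    rewrite -[m in X in cvg_to _ X]addr0.
    by apply: cvgD; [exact: cvg_cst|exact: cvg_harmonic].
  apply: cvgM; first exact: cvg_cst.
  apply: (cvg_comp u (fun z : V => `|z - v| ^+ 2) ucvg).
  apply: (@continuous_comp _ _ _ (fun y => `|y - v|) (fun r : R => r ^+ 2)).
    by apply: cvg_norm; apply: cvgB; [exact: cvg_id|exact: cvg_cst].
  exact: exprn_continuous.
exists p => z.
have hpm : (h p + (2^-1 * `|p - v| ^+ 2)%:E <= m%:E)%E.
  by rewrite -leeBrDr.
apply: (le_trans hpm).
move: (hNy z); case hz : (h z) => [r| |]// _; last exact: leey.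
by rewrite -EFinD lee_fin; apply: mle; rewrite hz.
Qed.

(** * Moreau's decomposition and reflected proximal maps *)

Section Moreau.
Context {R : realType} {V : hilbertType R}.
Implicit Types (h k : V -> \bar R) (u v p q : V).

(* Minimality of [q] in [prox k v] with the quadratic growth that convexity of
   [k] would give: convexity and closedness of conjugates need no proof. *)
Definition growth_min k v q := k q \is a fin_num /\
  forall u, (k q + (2^-1 * `|q - v| ^+ 2 + 2^-1 * `|u - q| ^+ 2)%:E <=
             k u + (2^-1 * `|u - v| ^+ 2)%:E)%E.

(** The growth term forces any other minimizer to be at distance 0 from [q], so [get] has only one
    choice. *)
Lemma prox_growth_min k v q : growth_min k v q -> prox k v = q.
Proof.
move=> [kq kmin]; apply: get_unique.
  move=> u; apply: le_trans (kmin u).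
  by rewrite leeD2l// lee_fin lerDl mulr_ge0.
move=> u /(_ q) kuq; have := le_trans (kmin u) kuq.
rewrite -(fineK kq) -!EFinD lee_fin => H.
have /eqP : `|u - q| ^+ 2 = 0.
  by apply/eqP; rewrite eq_le sqr_ge0 andbT; lra.
by rewrite sqrf_eq0 normr_eq0 subr_eq0 => /eqP.
Qed.

Lemma growth_min_opp k v q :
  growth_min k v q -> growth_min (k \o -%R) (- v) (- q).
Proof.
move=> [kq kmin]; split=> [|u]; first by rewrite /= opprK.
have /= := kmin (- u); rewrite opprK.
rewrite -[`|- u - q|]normrN -[`|- u - v|]normrN -[`|q - v|]normrN.
by rewrite !opprD !opprK.
Qed.

(** This says that [v - p] is a subgradient of [h] at [p]. Minimality is tested against points moved
    from [p] towards [z], and the result is divided by [t]. *)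
Lemma Gamma0_prox_variational h v p :
  Gamma0 h -> argmin (fun z => h z + (2^-1 * `|z - v| ^+ 2)%:E)%E p ->
  h p \is a fin_num /\
  forall z, (h p + '<[z - p, v - p]>%:E <= h z)%E.
Proof.
move=> [[hNy [x0 hx0]] hconv _] pmin.
have [r hp] : exists r, h p = r%:E.
  move: (hNy p) (pmin x0); case: (h p) => // [r|] _; first by exists r.
  by move: hx0 (hNy x0); case: (h x0).
split=> [|z]; first by rewrite hp.
move: (hNy z); case hz : (h z) => [a| |]// _; last by rewrite leey.
rewrite hp -EFinD lee_fin.
set i := '<[z - p, v - p]>; pose N := `|z - p| ^+ 2.
have N0 : 0 <= N by rewrite sqr_ge0.
have step t : 0 < t -> t <= 1 -> 0 <= (a - r - i) + 2^-1 * t * N.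
  move=> t0 t1.
  have hz' : (h z <= a%:E)%E by rewrite hz.
  have hp' : (h p <= r%:E)%E by rewrite hp.
  have hw := convex_fun_le hconv (ltW t0) t1 hz' hp'.
  have := le_trans (pmin _) (leeD2r _ hw).
  have -> : t *: z + (1 - t) *: p - v = t *: (z - p) - (v - p).
    rewrite scalerBl scale1r scalerBr opprB !addrA; congr (_ - _).
    by rewrite addrAC.
  rewrite hp -!EFinD lee_fin (distrC p v) (sqr_normB (t *: _)) innerZl normrZ exprMn.
  rewrite (gtr0_norm t0) -/i -/N => H.
  have : 0 <= t * ((a - r - i) + 2^-1 * t * N).
    by move: H; move: (`|v - p| ^+ 2) => ?; lra.
  by rewrite pmulr_rge0.
rewrite -subr_ge0 leNgt; apply/negP => X0.
set X := a - (r + i) in X0.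
have d0 : 0 < N - X by lra.
(* Instead of a limit [t -> 0], one explicit [t] in (0, 1] makes the right side of [step] negative
   when [X < 0]. *)
have := step (- X / (N - X)).
rewrite divr_gt0 ?oppr_gt0// ler_pdivrMr// => /(_ isT ltac:(lra)).
have -> : a - r - i = X by rewrite /X; ring.
have -> : X + 2^-1 * (- X / (N - X)) * N = X * (2^-1 * N - X) / (N - X).
  by field; rewrite gt_eqF.
by rewrite pmulr_lge0 ?invr_gt0// leNgt => /negP; apply; rewrite nmulr_rlt0//; lra.
Qed.

(** The subgradient inequality gives equality in Fenchel-Young at [p] and [v - p]. The conjugate
    therefore lies above an affine function touching it at [v - p]; adding the quadratic to this
    function gives exactly the growth bound. *)
Lemma fenchel_prox h v : Gamma0 h -> growth_min (fenchel h) v (v - prox h v).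
Proof.
move=> hG; have /getPex := prox_exists v hG; rewrite -/(prox h v).
set p := prox h v => pmin.
have [hpf var] := Gamma0_prox_variational hG pmin.
have Fq : fenchel h (v - p) = ('<[p, v - p]>%:E - h p)%E.
  apply/eqP; rewrite eq_le; apply/andP; split; last first.
    by apply: ereal_sup_ubound; exists p.
  apply: ge_ereal_sup => _ [z _ <-].
  have := var z; rewrite -(fineK hpf) innerBl.
  have [[+ _] _ _] := hG; move=> /(_ z); case: (h z) => [a _| _ _|//]; last exact: leNye.
  by rewrite -!EFinD !lee_fin; lra.
split=> [|u]; first by rewrite Fq -(fineK hpf).
apply: (@le_trans _ _ ('<[p, u]>%:E - h p + (2^-1 * `|u - v| ^+ 2)%:E)%E).
  rewrite Fq -(fineK hpf) -!EFinD lee_fin.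
  have -> : v - p - v = - p by rewrite addrAC subrr add0r.
  have -> : u - v = (u - (v - p)) - p.
    by rewrite opprB addrA (addrAC u) addrK.
  rewrite normrN (sqr_normB (u - _)) (innerC _ p) !innerBr.
  by move: (`|_| ^+ 2) (`|p| ^+ 2) => *; lra.
by apply: leeD2r; apply: ereal_sup_ubound; exists p.
Qed.

Lemma rprox_fenchel h v : Gamma0 h -> rprox (fenchel h) v = - rprox h v.
Proof.
move=> hG; rewrite /rprox (prox_growth_min (fenchel_prox v hG)).
by rewrite scalerBr opprB scaler_nat mulr2n addrAC addrK.
Qed.

Lemma rprox_fenchel_opp h v :
  Gamma0 h -> rprox (fenchel h \o -%R) v = rprox h (- v).
Proof.
move=> hG; have := growth_min_opp (fenchel_prox (- v) hG).
rewrite opprK opprB /rprox => /prox_growth_min ->.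
by rewrite opprK scalerDr (scaler_nat 2 v) mulr2n -addrA addrK.
Qed.

End Moreau.

Theorem mainTheorem2 (R : realType) (H P K : hilbertType R)
    (f : H -> \bar R) (g : P -> \bar R) (c : K) (A : H -> K) (B : P -> K)
    (hf : Gamma0 f) (hg : Gamma0 g)
    (hA : bounded_linear_iso A) (hB : bounded_linear_iso B)
    (rho : R) (hrho : rho != 0) :
  rprox (fbar f A c rho) \o rprox (ghat g B c rho) =
  rprox (fenchel (fbar f A c rho) \o -%R) \o rprox (fenchel (ghat g B c rho)).
Proof.
have fG : Gamma0 (fbar f A c rho).
  have [L Ls] := inv_op_scale_bounded_linear hrho hA.
  (* The subtracted linear form is an added one with vector [- (rho *: c)], so the same stability
     result applies. *)
  have -> : fbar f A c rho = (fun y => (f \o inv_op (fun x => rho *: A x)) y +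
      '<[- (rho *: c), y]>%:E)%E.
    by apply/funext => y; rewrite /fbar innerNl EFinN.
  exact/Gamma0_add_inner/Gamma0_comp.
have gG : Gamma0 (ghat g B c rho).
  have [L Ls] := inv_op_scale_bounded_linear hrho hB.
  exact: (Gamma0_add_inner (rho *: c) (Gamma0_comp L Ls hg)).
apply/funext => v /=.
by rewrite (rprox_fenchel _ gG) rprox_fenchel_opp// opprK.
Qed.
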